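(* Let $T_0:[0,1]\to[0,1]$ be Borel measurable and $\rho$ a Lipschitz probability density on $\mathbb R$ supported on $[-1,1]$. Let $L_0f(x)=\int k_0(x,y)f(y)\,dy$ on $L^2([0,1],\mathbb C)$ with $k_0(x,y)=(P_\pi\tau_{-T_0(y)}\rho)(x)$, satisfying (A1): $\lim_{n\to\infty}\|L_0^ng\|_2=0$ for every $g$ with $\int g\,dm=0$. Let $\lambda_0$ be a geometrically simple eigenvalue of $L_0$ of largest magnitude strictly inside the unit disk, with eigenvectors $e$ of $L_0$ and $\hat e$ of $L_0^*$ for $\lambda_0$, and let $\widehat E$ be the associated function defined in the context. Let $\ell\ge0$ and $P_\ell:=S_{T_0,\ell}\cap B_1$, and assume that $\mathcal J(\dot T)=\langle\dot T,\widehat E\rangle$ does not uniformly vanish on $P_\ell$. Then the problem of finding $\dot T\in P_\ell$ such that $$\langle\dot T,\widehat E\rangle_{L^2([0,1],\mathbb R)}=\min_{\dot h\in P_\ell}\langle\dot h,\widehat E\rangle_{L^2([0,1],\mathbb R)}$$ has a unique solution.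
   Context: $L^2=L^2([0,1],\mathbb R)$ with Lebesgue measure $m$. $(\tau_bg)(x):=g(x+b)$; $P_\pi f(x):=\sum_{i\in2\mathbb Z}(f(i+x)+f(i-x))$ for $x\in[0,1]$. $d\rho/dx$ is the a.e. derivative. $L_0^*g(y)=\int k_0(x,y)g(x)\,dx$. $$E(x,y):=\big(\Re(\hat e)(x)\Re(e)(y)+\Im(\hat e)(x)\Im(e)(y)\big)\Re(\lambda_0)+\big(\Im(\hat e)(x)\Re(e)(y)-\Re(\hat e)(x)\Im(e)(y)\big)\Im(\lambda_0),$$ $$\widehat E(y):=-\int_0^1\left(P_\pi\left(\tau_{-T_0(y)}\frac{d\rho}{dx}\right)\right)(x)E(x,y)\,dx .$$ $\widetilde F_\ell:=\{x\in[0,1]:\ell\le T_0(x)\le1-\ell\}$; $S_{T_0,\ell}:=\{T\in L^2:\mathrm{supp}(T)\subseteq\widetilde F_\ell\}$ (i.e. $T=0$ a.e. outside $\widetilde F_\ell$); $B_1$ is the closed unit ball of $L^2$. *)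

(* Defs.v *)
From HB Require Import structures.
From mathcomp Require Import all_boot all_order all_algebra.
From mathcomp Require Import all_classical all_reals all_analysis.
From mathcomp Require Import complex.

Set Implicit Arguments.
Unset Strict Implicit.
Unset Printing Implicit Defensive.

Import Order.TTheory GRing.Theory Num.Theory.
Import numFieldNormedType.Exports.

Local Notation Re := complex.Re.
Local Notation Im := complex.Im.

Local Open Scope classical_set_scope.
Local Open Scope ring_scope.
Local Open Scope complex_scope.

Section LinearResponse.
Context {R : realType}.

(* Functions on [0,1] are encoded as total functions on R whose values off
   [0,1] are irrelevant: [leb01] gives no mass to the complement of [0,1],
   and integrands are cut down to [0,1]. *)
Definition leb01 : {measure set (measurableTypeR R) -> \bar R} :=
  mrestr (@lebesgue_measure R) (measurable_itv `[0, 1]).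

Definition L2real : Type := LspaceType2 leb01.

Definition inL2C (f : R -> R[i]) : Prop :=
  ((fun x => Re (f x)) \in Lfun leb01 2%:E) /\
  ((fun x => Im (f x)) \in Lfun leb01 2%:E).

Definition normL2C (f : R -> R[i]) : \bar R :=
  'N[leb01]_(2%:E)[EFin \o (@ComplexField.Normc.normc R \o f)].

Definition integralC (f : R -> R[i]) : R[i] :=
  (\int[leb01]_(x in `[0, 1]) Re (f x)) +i* (\int[leb01]_(x in `[0, 1]) Im (f x)).

Definition tau (b : R) (g : R -> R) : R -> R := fun x => g (x + b).

(* [\sum_(i \in A)] sums the nonzero terms when these are finitely many and is
   0 otherwise; [P_pi] is only applied to [f] with bounded support. *)
Definition P_pi (f : R -> R) (x : R) : R :=
  \sum_(i \in [set i : int | (2 %| i)%Z]) (f (i%:~R + x) + f (i%:~R - x)).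

Definition k0 (T0 rho : R -> R) (x y : R) : R := P_pi (tau (- T0 y) rho) x.

Definition L0 (T0 rho : R -> R) (f : R -> R[i]) (x : R) : R[i] :=
  integralC (fun y => (k0 T0 rho x y)%:C * f y).

Definition L0adj (T0 rho : R -> R) (g : R -> R[i]) (y : R) : R[i] :=
  integralC (fun x => (k0 T0 rho x y)%:C * g x).

Definition lipschitz_density (rho : R -> R) : Prop :=
  [/\ lipschitz rho,
      forall x, 0 <= rho x,
      (\int[@lebesgue_measure R]_x (rho x)%:E = 1)%E &
      forall x, x \notin `[-1, 1] -> rho x = 0].

Definition mixing (T0 rho : R -> R) : Prop :=
  forall g : R -> R[i], inL2C g -> integralC g = 0 ->
    (fun n => normL2C (iter n (L0 T0 rho) g)) @ \oo --> 0%E.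

Definition is_eigenvector (A : (R -> R[i]) -> R -> R[i]) (lam : R[i])
    (f : R -> R[i]) : Prop :=
  [/\ inL2C f, ~ {ae leb01, forall x, f x = 0} &
      {ae leb01, forall x, A f x = lam * f x}].

Definition is_eigenvalue (A : (R -> R[i]) -> R -> R[i]) (lam : R[i]) : Prop :=
  exists f, is_eigenvector A lam f.

Definition geom_simple (A : (R -> R[i]) -> R -> R[i]) (lam : R[i]) : Prop :=
  exists2 f, is_eigenvector A lam f &
    forall g, is_eigenvector A lam g ->
      exists c : R[i], {ae leb01, forall x, g x = c * f x}.

Definition largest_inside_disk (A : (R -> R[i]) -> R -> R[i]) (lam : R[i]) :
    Prop :=
  [/\ is_eigenvalue A lam, `|lam| < 1 &
      forall mu : R[i], is_eigenvalue A mu -> `|mu| < 1 -> `|mu| <= `|lam|].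

Definition Efun (e ehat : R -> R[i]) (lam0 : R[i]) (x y : R) : R :=
  (Re (ehat x) * Re (e y) + Im (ehat x) * Im (e y)) * Re lam0
  + (Im (ehat x) * Re (e y) - Re (ehat x) * Im (e y)) * Im lam0.

(* [derive1 rho] is the derivative where it exists and a constant elsewhere; for
   Lipschitz [rho] the exceptional set is null and is ignored by the integral. *)
Definition Ehat (T0 rho : R -> R) (e ehat : R -> R[i]) (lam0 : R[i]) (y : R) :
    R :=
  - \int[leb01]_(x in `[0, 1])
      (P_pi (tau (- T0 y) (derive1 rho)) x * Efun e ehat lam0 x y).

Definition innerL2 (f g : R -> R) : R :=
  \int[leb01]_(x in `[0, 1]) (f x * g x).

Definition Ftilde (T0 : R -> R) (l : R) : set R :=
  [set x | x \in `[0, 1] /\ l <= T0 x <= 1 - l].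

Definition S_T0 (T0 : R -> R) (l : R) : set L2real :=
  [set T : L2real | {ae leb01, forall x, ~ Ftilde T0 l x -> T x = 0}].

Definition unit_ball : set L2real :=
  [set T : L2real | ('N[leb01]_(2%:E)[EFin \o T] <= 1)%E].

Definition Pset (T0 : R -> R) (l : R) : set L2real :=
  S_T0 T0 l `&` unit_ball.

End LinearResponse.

Arguments L2real R : clear implicits.

(* Main.v *)
(* The derivative of a Lipschitz function is bounded and Borel, so the kernel
   defining [Ehat] is dominated by a product of two square-integrable functions
   and [Ehat] itself lies in L^2.  Restricting it to the Borel set [Ftilde]
   gives a vector [v] with [J T = <T, v>] on the feasible set; [v <> 0] since
   [J] does not vanish there, and a nonzero linear form has exactly one
   minimizer on the unit ball of a Hilbert space, namely [- v / ||v||]. *)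
Require Import Defs.
From HB Require Import structures.
From mathcomp Require Import all_boot all_order all_algebra.
From mathcomp Require Import all_classical all_reals all_analysis.
From mathcomp Require Import complex.
From mathcomp Require Import measurable_realfun ring lra zify.

Import Order.TTheory GRing.Theory Num.Theory.
Import numFieldNormedType.Exports.
Local Open Scope classical_set_scope.
Local Open Scope ring_scope.
Local Open Scope complex_scope.

(** * Measurability, size and support of derivatives *)

Section DifferenceQuotients.
Local Set Implicit Arguments.
Local Unset Strict Implicit.
Context {R : realType}.
Implicit Types (f : R -> R) (a b h x k M : R).

Let quot f a h := h^-1 *: (f (h + a) - f a).

Lemma continuous_difference_quotient f h :
  continuous f -> continuous (fun x => quot f x h).
Proof.
move=> cf x; apply: cvgZr; apply: cvgB; last exact: cf.
apply: (@continuous_comp _ _ _ (fun y => h + y) f); last exact: cf.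
by apply: cvgD; [exact: cvg_cst|exact: cvg_id].
Qed.

(* By Cauchy's criterion the set is a countable intersection of countable
   unions of closed sets. *)
Lemma measurable_differentiability_set f : continuous f ->
  measurable [set x | cvg (quot f x @ 0^')].
Proof.
move=> cf.
rewrite (_ : mkset _ = \bigcap_n \bigcup_m
  \bigcap_(p in [set p : R * R | [/\ p.1 != 0, p.2 != 0,
      `|p.1| < m.+1%:R^-1 & `|p.2| < m.+1%:R^-1]])
  [set x | `|quot f x p.1 - quot f x p.2| <= n.+1%:R^-1]).
  apply: bigcap_measurableType => n _; apply: bigcup_measurable => m _.
  (* The pairs [p] of increments form an uncountable set; the intersection is still closed, since
     each quotient is continuous in [x]. *)
  apply: closed_measurable; apply: closed_bigI => p _.
  apply: (@preimage_closed _ _ (fun x => `|quot f x p.1 - quot f x p.2|)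
    [set y | y <= n.+1%:R^-1]) ; last exact: closed_le.
  move=> x _; apply: cvg_norm.
  by apply: cvgB; apply: continuous_difference_quotient.
apply/seteqP; split => x /=.
- move=> /cauchy_cvgP/cauchy_ballP cx n _.
  have [[A B] /= [[r1 /= r10 A0] [r2 /= r20 B0]] AB] :=
    cx n.+1%:R^-1 ltac:(by rewrite invr_gt0).
  have r0 : 0 < Num.min r1 r2 by rewrite lt_min r10.
  have [m _ mr] := near_infty_natSinv_lt (PosNum r0).
  have {mr} : m.+1%:R^-1 < Num.min r1 r2 by exact: (mr m (leqnn m)).
  rewrite lt_min => /andP[mr1 mr2].
  exists m => // -[h1 h2] /= [h10 h20 h1m h2m].
  have Ah1 : A (quot f x h1).
    by apply: A0 => //; rewrite /ball_/= sub0r normrN (lt_trans h1m).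
  have Bh2 : B (quot f x h2).
    by apply: B0 => //; rewrite /ball_/= sub0r normrN (lt_trans h2m).
  by apply/ltW; exact: (AB (quot f x h1, quot f x h2)).
- move=> cx; apply/cauchy_cvgP/cauchy_ballP => _/posnumP[eps].
  have [n _ neps] := near_infty_natSinv_lt eps.
  have [m _ mx] := cx n I.
  pose A : set R := [set h | h != 0 /\ `|h| < m.+1%:R^-1].
  have nA : nbhs 0^' A.
    exists m.+1%:R^-1 => /=; first by rewrite invr_gt0.
    by move=> h; rewrite /ball_/= sub0r normrN => hm h0; split.
  exists (quot f x @` A, quot f x @` A) => /=.
    split; apply: filterS nA => h Ah; exists h => //.
  move=> [_ _] /= [[h1 [h10 h1m] <-] [h2 [h20 h2m] <-]].
  have := mx (h1, h2) (And4 h10 h20 h1m h2m).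
  by move=> /le_lt_trans; apply; exact: (neps n (leqnn n)).
Qed.

(** On the Borel set where the quotients converge, the derivative is the pointwise limit of the
    continuous quotients with increments [1/(n+1)]; on the complement it is the constant default
    value [point]. *)
Lemma measurable_derive1 f : continuous f -> measurable_fun setT (derive1 f).
Proof.
move=> cf.
have mD := measurable_differentiability_set cf.
rewrite (_ : setT = [set x | cvg (quot f x @ 0^')] `|`
    ~` [set x | cvg (quot f x @ 0^')]); last by rewrite setUv.
apply/measurable_funU => //; first exact: measurableC.
split; last first.
  apply: (eq_measurable_fun (cst point)) => // x; rewrite inE /= => ncv.
  by rewrite /derive1; apply/esym/dvgP.
apply: (@measurable_fun_cvg _ _ R _ (fun n x => quot f x n.+1%:R^-1)) =>
  [n|x /= cx].
  apply: measurable_funTS; apply: continuous_measurable_fun.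
  exact: continuous_difference_quotient.
rewrite -/(derive1 f x).
(* The sequence never takes the value 0, so it converges along the punctured filter as well. *)
have hN : (fun n : nat => n.+1%:R^-1 : R) @ \oo --> 0^'.
  move=> A /= A0; have : \forall n \near \oo,
      (n.+1%:R^-1 : R) != 0 -> A n.+1%:R^-1 by exact: (cvg_harmonic A0).
  by apply: filterS => n; apply; rewrite invr_eq0 pnatr_eq0.
apply: (@cvg_comp _ _ _ (fun n : nat => n.+1%:R^-1 : R) (quot f x) _ _ _ hN).
exact: cx.
Qed.

(** Quotients with nonzero increment are bounded by [M], and a closed bound passes to the limit.
    Where there is no limit, the default value in [R] is 0, hence the preliminary [0 <= M]. *)
Lemma derive1_bounded f M : (forall x y, `|f x - f y| <= M * `|x - y|) ->
  forall x, `|derive1 f x| <= M.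
Proof.
move=> fM x.
have M0 : 0 <= M.
  by have := fM 1 0; rewrite subr0 normr1 mulr1; apply: le_trans.
have [cx|ncx] := pselect (cvg (quot f x @ 0^')); last first.
  by rewrite /derive1 (dvgP ncx) normr0.
apply: (@closed_cvg _ _ 0^' _ (fun h => `|quot f x h|) (fun y : R => y <= M)
  _ _ _ (cvg_norm cx)); first exact: closed_le.
near=> h; have h0 : h != 0 by near: h; exact: nbhs_dnbhs_neq.
rewrite /quot normrZ normfV ler_pdivrMl ?normr_gt0//.
by rewrite (le_trans (fM _ _))// addrK mulrC.
Unshelve. all: end_near. Qed.

Lemma derive1_eq0_out f a b : (forall x, x \notin `[a, b] -> f x = 0) ->
  forall x, x \notin `[a, b] -> derive1 f x = 0.
Proof.
move=> f0 x xab; have nx : \forall y \near x, f y = 0.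
  have : open (~` [set` `[a, b]]) by apply: closed_openC; exact: itv_closed.
  rewrite openE => /(_ x); rewrite /interior /=.
  move=> /(_ ltac:(exact/negP)); apply: filterS => y /= /negP; exact: f0.
by rewrite derive1E (@near_eq_derive _ _ _ f (cst 0)) ?derive_cst.
Qed.

End DifferenceQuotients.

(** * Square-integrable functions, described through the integral of the square *)

Section SquareIntegrable.
Local Set Implicit Arguments.
Local Unset Strict Implicit.
Context d (X : measurableType d) (R : realType).
Variable mu : {measure set X -> \bar R}.
Implicit Types f g : X -> R.

Lemma sqr_Lnorm2 f :
  ('N[mu]_2%:E[EFin \o f] `^ 2 = \int[mu]_x (f x ^+ 2)%:E)%E.
Proof.
rewrite powR_Lnorm ?pnatr_eq0//; apply: eq_integral => x _ /=.
by rewrite powR_mulrn// real_normK// num_real.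
Qed.

Lemma Lnorm2_le1 f :
  ('N[mu]_2%:E[EFin \o f] <= 1)%E = (\int[mu]_x (f x ^+ 2)%:E <= 1)%E.
Proof.
rewrite -sqr_Lnorm2; have := Lnorm_ge0 mu 2%:E (EFin \o f).
case: ('N[mu]_2%:E[EFin \o f])%E => [r| |] //=.
  by rewrite !lee_fin => r0; rewrite powR_mulrn// expr_le1.
by rewrite pnatr_eq0.
Qed.

Lemma Lfun2P f : f \in Lfun mu 2%:E <->
  measurable_fun setT f /\ mu.-integrable setT (EFin \o (fun x => f x ^+ 2)).
Proof.
split=> [f2|[mf /integrableP[_ f2]]].
  split; last exact: Lfun2_integrable_sqr.
  by move: f2; rewrite inE => /andP[/[!inE]].
rewrite inE; apply/andP; split; rewrite inE//= /finite_norm.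
rewrite (@lty_poweRy _ _ 2)// sqr_Lnorm2; move: f2.
by under eq_integral => x _ do rewrite /= ger0_norm ?sqr_ge0//.
Qed.

Lemma Lfun2_le f g : measurable_fun setT f -> g \in Lfun mu 2%:E ->
  (forall x, `|f x| <= `|g x|) -> f \in Lfun mu 2%:E.
Proof.
move=> mf /Lfun2P[mg ig] fg; apply/Lfun2P; split => //.
apply: le_integrable ig => //=.
  by apply/measurable_EFinP; exact: measurable_funX.
by move=> x _; rewrite lee_fin !normrX lerXn2r ?nnegrE.
Qed.

Lemma Lfun2M_integrable f g : f \in Lfun mu 2%:E -> g \in Lfun mu 2%:E ->
  mu.-integrable setT (EFin \o (fun x => f x * g x)).
Proof. by move=> f2 g2; apply/Lfun1_integrable; exact: Lfun2_mul_Lfun1. Qed.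

End SquareIntegrable.

(** * Elements of Lebesgue spaces and their representatives *)

Section LspaceRepresentatives.
Local Open Scope quotient_scope.
Local Set Implicit Arguments.
Local Unset Strict Implicit.
Context d (X : measurableType d) (R : realType).
Variables (mu : {measure set X -> \bar R}) (p : \bar R) (p1 : (1 <= p)%E).

Lemma LspaceP (T : LspaceType mu p1) : (T : X -> R) \in Lfun mu p.
Proof.
rewrite inE; apply/andP; split; rewrite inE.
  exact: (measurable_funPT (repr (LebesgueSpace.sort T))).
exact: (@Lebesgue_finite _ _ _ _ _ _ T).
Qed.

(** An element is a class of measurable functions packed with a proof of finite norm: the classes
    agree by the quotient relation, the proofs by irrelevance. This yields the Leibniz equality that
    uniqueness asks for. *)
Lemma Lspace_ae_eq (S T : LspaceType mu p1) :
  {ae mu, forall x, S x = T x} -> S = T.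
Proof.
case: S => s [[hs]]; case: T => t [[ht]] /= st.
suff E : s = t by case: t / E ht st => ht _; rewrite (Prop_irrelevance hs ht).
rewrite -[s]reprK -[t]reprK; apply/eqquotP/asboolP.
by apply: filterS st.
Qed.

End LspaceRepresentatives.

(** * From square-integrable functions to elements of $L^2$ *)

Section LspaceTwo.
Local Set Implicit Arguments.
Local Unset Strict Implicit.
Local Open Scope quotient_scope.

(** Measurability of [g] is a separate hypothesis because [mu] need not be complete. *)
Lemma ae_eq_Lfun2 d (X : measurableType d) (R : realType)
    (mu : {measure set X -> \bar R}) (f g : X -> R) : measurable_fun setT g ->
  {ae mu, forall x, g x = f x} -> f \in Lfun mu 2%:E -> g \in Lfun mu 2%:E.
Proof.
move=> mg gf /Lfun2P[mf /integrableP[_ fi]]; apply/Lfun2P; split => //.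
have mX (h : X -> R) : measurable_fun setT h ->
    measurable_fun setT (EFin \o (fun x : X => h x ^+ 2)).
  by move=> mh; apply/measurable_EFinP; exact: measurable_funX.
apply/integrableP; split; first exact: mX.
rewrite (_ : integral _ _ _ = \int[mu]_x `|(f x ^+ 2)%:E|)%E//.
apply: ae_eq_integral => //; try by apply: measurableT_comp => //; exact: mX.
by apply: filterS gf => x gfx _ /=; rewrite gfx.
Qed.

(** Turns an explicit function, such as the candidate minimizer, into an element of $L^2$. The
    representative picked by the quotient agrees with [f] only almost everywhere. *)
Lemma Lspace_of_Lfun2 d (X : measurableType d) (R : realType)
    (mu : {measure set X -> \bar R}) (f : X -> R) : f \in Lfun mu 2%:E ->
  exists T : LspaceType2 mu, {ae mu, forall x, T x = f x}.
Proof.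
move=> f2; have /Lfun2P[mf _] := f2.
pose m : {mfun X >-> measurableTypeR R} :=
  HB.pack f (isMeasurableFun.Build _ _ X (measurableTypeR R) f mf).
pose q : {mfun_ mu, X >-> measurableTypeR R} := \pi m.
have qf : {ae mu, forall x, q x = f x}.
  have : repr q = m %[mod {mfun_ mu, X >-> measurableTypeR R}] by rewrite reprK.
  by move=> /eqquotP/asboolP; apply: filterS => x; exact.
have fin : finite_norm mu 2%:E q.
  have : (q : X -> R) \in Lfun mu 2%:E.
    by apply: ae_eq_Lfun2 qf f2; exact: (measurable_funPT (repr q)).
  by rewrite inE => /andP[_] /[!inE].
by exists (HB.pack_for (LspaceType2 mu) q
  (isFinLebesgue.Build _ _ _ mu 2%:E (lee1n 2) q fin)).
Qed.

End LspaceTwo.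

(** * Minimizing a linear form on the unit ball of a subspace of $L^2$ *)

Section BallMinimizer.
Local Set Implicit Arguments.
Local Unset Strict Implicit.
Context d (X : measurableType d) (R : realType).
Variable mu : {measure set X -> \bar R}.
Implicit Types f g : X -> R.

Lemma ae_eq_Rintegral f g :
  mu.-integrable setT (EFin \o f) -> mu.-integrable setT (EFin \o g) ->
  {ae mu, forall x, f x = g x} -> \int[mu]_x f x = \int[mu]_x g x.
Proof.
move=> /integrableP[mf _] /integrableP[mg _] fg; congr fine.
by apply: ae_eq_integral => //; apply: filterS fg => x /= ->.
Qed.

(** Used twice below: to exclude that [v] has norm zero, and to turn the equality case of the
    distance estimate into uniqueness. *)
Lemma Rintegral_sqr_le0 f : f \in Lfun mu 2%:E -> \int[mu]_x (f x ^+ 2) <= 0 ->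
  {ae mu, forall x, f x = 0}.
Proof.
move=> /[dup] f2 /Lfun2P[mf /[dup] fi /integrableP[mf2 _]] le0.
have /(ae_eq_integral_abs mu measurableT mf2) :
    (\int[mu]_x `|(f x ^+ 2)%:E| = 0)%E.
  under eq_integral => x _ do rewrite /= ger0_norm ?sqr_ge0//.
  rewrite -[LHS]fineK; last exact: integrable_fin_num.
  congr EFin; apply/eqP; rewrite eq_le le0/=.
  by apply: Rintegral_ge0 => x _; exact: sqr_ge0.
by apply: filterS => x /(_ I)[/eqP]; rewrite sqrf_eq0 => /eqP.
Qed.

Lemma Lnorm2_Rint_le1 f : f \in Lfun mu 2%:E ->
  ('N[mu]_2%:E[EFin \o f] <= 1)%E = (\int[mu]_x (f x ^+ 2) <= 1).
Proof.
move=> /Lfun2P[_ fi]; rewrite Lnorm2_le1 -lee_fin fineK//.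
exact: integrable_fin_num.
Qed.

(* With [v] the restriction of [g] to [A] and [N] its norm, the minimizer is
   [- v / N]: every admissible [T] satisfies
   [0 <= ||T + v / N||^2 = ||T||^2 + 2 <T, g> / N + 1 <= 2 (1 + <T, g> / N)]. *)
Lemma linear_form_ball_unique_minimizer (A : set X) g :
  measurable A -> g \in Lfun mu 2%:E ->
  let P : set (LspaceType2 mu) := [set T : LspaceType2 mu |
    {ae mu, forall x, ~ A x -> T x = 0} /\ ('N[mu]_2%:E[EFin \o T] <= 1)%E] in
  let J (T : LspaceType2 mu) := \int[mu]_x (T x * g x) in
  ~ (forall T, P T -> J T = 0) ->
  exists! T, P T /\ forall h, P h -> J T <= J h.
Proof.
move=> mA g2 P J Jneq0; have /Lfun2P[mg _] := g2.
pose v := g \_ A.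
have mv : measurable_fun setT v.
  by apply/(measurable_restrictT _ mA); exact: measurable_funTS.
have v2 : v \in Lfun mu 2%:E.
  apply: Lfun2_le mv g2 _ => x; rewrite /v patchE.
  by case: ifPn => // _; rewrite normr0.
have T2 (T : LspaceType2 mu) := LspaceP T.
have JE T : P T -> J T = \int[mu]_x (T x * v x).
  move=> [TA _]; apply: ae_eq_Rintegral; try exact: Lfun2M_integrable.
  apply: filterS TA => x TA; rewrite /v patchE; case: ifPn => // /negP.
  by rewrite inE => /TA ->; rewrite !mul0r.
have /Lfun2P[_ iv] := v2.
pose N2 := \int[mu]_x (v x ^+ 2).
have N2_gt0 : 0 < N2.
  rewrite lt_neqAle Rintegral_ge0 ?andbT; last by move=> x _; exact: sqr_ge0.
  apply/eqP => N20; apply: Jneq0 => T PT; rewrite JE//.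
  have v0 : {ae mu, forall x, v x = 0}.
    by apply: Rintegral_sqr_le0; rewrite // -/N2 -N20.
  rewrite (@ae_eq_Rintegral _ (fun x => 0 : R)).
  - by rewrite Rintegral_cst// mul0r.
  - exact: Lfun2M_integrable.
  - exact: integrable0.
  - by apply: filterS v0 => x ->; rewrite mulr0.
pose N := Num.sqrt N2.
have N_gt0 : 0 < N by rewrite sqrtr_gt0.
have NE : N2 = N ^+ 2 by rewrite sqr_sqrtr// ltW.
pose w x := N^-1 * v x.
have w2 : w \in Lfun mu 2%:E.
  apply/Lfun2P; split; first exact: measurable_funM.
  rewrite (_ : _ \o _ = (fun x => (N^-1 ^+ 2)%:E * (v x ^+ 2)%:E)%E).
    exact: integrableZl.
  by apply/funext => x /=; rewrite /w exprMn EFinM.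
have /Lfun2P[_ iw] := w2.
have intw : \int[mu]_x (w x ^+ 2) = 1.
  under eq_Rintegral => x _ do rewrite exprMn.
  by rewrite RintegralZl// -/N2 NE exprVn mulVf// sqrf_eq0 gt_eqF.
have dist2 T : P T -> \int[mu]_x ((T x + w x) ^+ 2) <= 2 * (1 + J T / N).
  move=> PT; have := PT.2; rewrite Lnorm2_Rint_le1// => T1.
  have /Lfun2P[_ iT] := T2 T.
  have iTv := Lfun2M_integrable (T2 T) v2.
  have iTv' : mu.-integrable setT (EFin \o (fun x => 2 * N^-1 * (T x * v x))).
    exact: (@integrableZl _ _ _ mu setT measurableT (2 * N^-1) _ iTv).
  rewrite (@eq_Rintegral _ _ _ _ _ (fun x =>
      T x ^+ 2 + 2 * N^-1 * (T x * v x) + w x ^+ 2)); last first.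
    by move=> x _; rewrite /w; ring.
  rewrite RintegralD//; 
    last exact: (@integrableD _ _ _ mu setT measurableT _ _ iT iTv').
  rewrite RintegralD// RintegralZl// -JE// intw.
  have -> : 2 * (1 + J T / N) = 1 + 2 / N * J T + 1 by ring.
  by rewrite !lerD2r.
have wN2 : (fun x => - w x) \in Lfun mu 2%:E.
  apply: Lfun2_le w2 _ => [|x]; last by rewrite normrN.
  by apply: measurableT_comp => //; exact: measurable_funM.
have [M Mw] := Lspace_of_Lfun2 wN2.
have PM : P M.
  split.
    apply: filterS Mw => x -> Ax; rewrite /w /v patchE memNset//.
    by rewrite mulr0 oppr0.
  rewrite Lnorm2_Rint_le1//.
  have /Lfun2P[_ iM] := T2 M.
  rewrite (@ae_eq_Rintegral _ (fun x => w x ^+ 2)) ?intw//.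
  by apply: filterS Mw => x ->; rewrite sqrrN.
have JM : J M = - N.
  rewrite JE// (@ae_eq_Rintegral _ (fun x => - N^-1 * v x ^+ 2)).
  - by rewrite RintegralZl// -/N2 NE; field; rewrite gt_eqF.
  - exact: Lfun2M_integrable.
  - exact: (@integrableZl _ _ _ mu setT measurableT (- N^-1) _ iv).
  - by apply: filterS Mw => x ->; rewrite /w; ring.
have minJ h : P h -> - N <= J h.
  (* The squared distance is nonnegative, so [0 <= 2 * (1 + J h / N)]. *)
  move=> /dist2; set I := Rintegral _ _ _.
  have I0 : 0 <= I by apply: Rintegral_ge0 => x _; exact: sqr_ge0.
  move=> /(le_trans I0).
  by rewrite pmulr_rge0// -lerBlDl sub0r ler_pdivlMr// mulN1r.
exists M; split=> [|h [Ph hmin]].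
  by split=> // h Ph; rewrite JM minJ.
have hN : J h = - N.
  by apply/eqP; rewrite eq_le minJ// andbT -JM hmin.
apply: Lspace_ae_eq; have := dist2 h Ph.
(* At the value [- N] the bound of [dist2] is 0, which forces [h = - w = M] almost everywhere. *)
rewrite hN mulNr mulfV ?gt_eqF// subrr mulr0 => /Rintegral_sqr_le0 h0.
have /h0 : (fun x => h x + w x) \in Lfun mu 2%:E.
  by have [_] := Lfun_addr_closed mu (lee1n 2); apply.
by apply: filterS2 Mw => x -> /eqP; rewrite addr_eq0 => /eqP ->.
Qed.

End BallMinimizer.

(** * Measurability and square integrability of parameter integrals *)

Section IntegralOperatorKernel.
Local Set Implicit Arguments.
Local Unset Strict Implicit.
Context d (X : measurableType d) (R : realType).
Variable mu : {sigma_finite_measure set X -> \bar R}.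

(** Tonelli applies to the positive and negative parts separately, so no integrability of [f] is
    required; the real integral is [fine] of the difference. *)
Lemma measurable_fun_Rintegral_kernel (f : X * X -> R) :
  measurable_fun setT f -> measurable_fun setT (fun y => \int[mu]_x f (y, x)).
Proof.
move=> mf; apply: measurableT_comp => //.
have mF : measurable_fun setT (EFin \o f) by exact/measurable_EFinP.
rewrite (_ : (fun y => _) = (fun y => \int[mu]_x (EFin \o f)^\+ (y, x) -
    \int[mu]_x (EFin \o f)^\- (y, x))%E).
  apply: emeasurable_funB.
    by apply: measurable_fun_fubini_tonelli_F => //; exact: measurable_funepos.
  by apply: measurable_fun_fubini_tonelli_F => //; exact: measurable_funeneg.
apply/funext => y; rewrite integralE.
by congr (_ - _)%E; apply: eq_integral => x _; rewrite !(funeposE, funenegE).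
Qed.

(** Integrating the domination in [x] bounds the result at [y] by the constant [\int a] times
    [b y]. *)
Lemma Lfun2_Rintegral_kernel (f : X * X -> R) (a b : X -> R) :
  measurable_fun setT f -> mu.-integrable setT (EFin \o a) ->
  b \in Lfun mu 2%:E -> (forall y x, `|f (y, x)| <= a x * b y) ->
  (fun y => \int[mu]_x f (y, x)) \in Lfun mu 2%:E.
Proof.
move=> mf ia b2 fab; pose c := \int[mu]_x a x.
have mI := measurable_fun_Rintegral_kernel mf.
apply: (@Lfun2_le _ _ _ _ _ (c \o* b)) => //; 
  first by apply: Lfun_scale; rewrite ?ler1n.
move=> y /=; apply: le_trans (ler_norm _).
have iab : mu.-integrable setT (EFin \o (fun x => a x * b y)).
  exact: (@integrableZr _ _ _ mu setT measurableT (b y) _ ia).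
have mfy : measurable_fun setT (fun x => f (y, x)).
  exact: (measurableT_comp mf (pair1_measurable y)).
have ify : mu.-integrable setT (EFin \o (fun x => f (y, x))).
  apply: le_integrable iab => //; first exact/measurable_EFinP.
  by move=> x _ /=; rewrite lee_fin (le_trans (fab y x))// ler_norm.
apply: le_trans (le_normr_Rintegral _ _) _ => //.
rewrite mulrC -RintegralZr//; apply: le_Rintegral => //.
by apply: (@integrable_norm _ _ _ mu setT (fun x => f (y, x))).
Qed.

End IntegralOperatorKernel.

(** * Square integrability of [Ehat] on the unit interval *)

Section ResponseFunction.
Local Set Implicit Arguments.
Local Unset Strict Implicit.
Context {R : realType}.
Implicit Types (f rho : R -> R) (e ehat : R -> R[i]).

Let leb01_lty : (@lebesgue_measure R `[0%R, 1%R]%classic < +oo)%E.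
Proof. by rewrite lebesgue_measure_itv/= lte_fin ltr01 -EFinB ltry. Qed.

(* [leb01] again, packed with the finiteness that its declared type forgets. *)
Let leb01_finite : {finite_measure set (measurableTypeR R) -> \bar R} :=
  @mfrestr _ (measurableTypeR R) R _ _ (measurable_itv `[0, 1]) leb01_lty.

(** The window [[-1, 2]] contains every translate of [[-1, 1]] by an amount in [[0, 1]]. For [x] in
    [[0, 1]], an index at most -3 or at least 4 sends both arguments out of it. The explicit sum
    makes measurability and bounds immediate. *)
Lemma P_pi_unit_interval f x : (forall z, z \notin `[-1, 2] -> f z = 0) ->
  x \in `[0, 1] ->
  P_pi f x =
  \sum_(i <- [:: -2; 0; 2] : seq int) (f (i%:~R + x) + f (i%:~R - x)).
Proof.
move=> f0 /[!in_itv]/= /andP[x0 x1].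
rewrite /P_pi (fsbigE [:: -2; 0; 2]) //=.
- by rewrite !big_cons !big_nil !mem_set.
- by move=> i; rewrite /= !inE => /or3P[] /eqP ->.
- move=> i /= /dvdzP[q iq]; rewrite !inE !negb_or => /and3P[i_m2 i_0 i_2].
  have {}iq : i = q * 2 :> int := iq.
  have [i3|i3] : i <= -3 \/ 4 <= i by lia.
  + have : i%:~R <= -3 :> R by rewrite -(ler_int R) in i3.
    move=> iR; rewrite !f0 ?addr0// in_itv/= negb_and -!ltNge;
      by apply/orP; left; lra.
  + have : 4 <= i%:~R :> R by rewrite -(ler_int R) in i3.
    move=> iR; rewrite !f0 ?addr0// in_itv/= negb_and -!ltNge;
      by apply/orP; right; lra.
Qed.

Lemma measurable_Ftilde (T0 : R -> R) l :
  measurable_fun (`[0, 1]%classic : set R) T0 ->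
  measurable (Ftilde T0 l).
Proof.
move=> mT0; rewrite (_ : Ftilde T0 l =
    `[0, 1]%classic `&` T0 @^-1` `[l, 1 - l]%classic); first exact: mT0.
by apply/seteqP; split => x; rewrite /Ftilde/= in_itv/= => -[].
Qed.

Lemma lipschitz_bound_continuous f (M : R) :
  (forall x y, `|f x - f y| <= M * `|x - y|) -> continuous f.
Proof.
move=> fM x; apply/cvgrPdist_lt => eps eps0.
have M0 : 0 < `|M| + 1 by rewrite ltr_wpDl.
near=> y; apply: le_lt_trans (fM x y) _.
have : `|x - y| < eps / (`|M| + 1).
  by near: y; exists (eps / (`|M| + 1)); rewrite //= divr_gt0.
rewrite ltr_pdivlMr// mulrC; apply: le_lt_trans.
by rewrite ler_wpM2r// (le_trans (ler_norm M))// lerDl.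
Unshelve. all: by end_near. Qed.

(** The bound separates [x] from [y], as the domination in [Lfun2_Rintegral_kernel] demands. *)
Lemma Efun_bound e ehat (lam0 : R[i]) x y : `|Efun e ehat lam0 x y| <=
  (`|complex.Re lam0| + `|complex.Im lam0|) *
  (`|complex.Re (ehat x)| + `|complex.Im (ehat x)|) *
  (`|complex.Re (e y)| + `|complex.Im (e y)|).
Proof.
rewrite /Efun; move: (complex.Re (ehat x)) (complex.Im (ehat x)) => a b.
move: (complex.Re (e y)) (complex.Im (e y)) => c d.
move: (complex.Re lam0) (complex.Im lam0) => r s.
pose Q := (`|a| + `|b|) * (`|c| + `|d|).
rewrite -[leRHS]mulrA -/Q [leRHS]mulrDl; apply: le_trans (ler_normD _ _) _.
rewrite normrM [X in _ + X]normrM.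
have := (mulr_ge0 (normr_ge0 a) (normr_ge0 c),
  mulr_ge0 (normr_ge0 a) (normr_ge0 d), mulr_ge0 (normr_ge0 b) (normr_ge0 c),
  mulr_ge0 (normr_ge0 b) (normr_ge0 d)).
move=> [[[ac ad] bc] bd].
by apply: lerD; rewrite mulrC; apply: ler_wpM2l => //;
  [apply: le_trans (ler_normD _ _) _|apply: le_trans (ler_normB _ _) _];
  rewrite !normrM /Q; lra.
Qed.

Lemma Lfun2_normD f g :
  f \in Lfun (@leb01 R) 2%:E -> g \in Lfun (@leb01 R) 2%:E ->
  (fun x => `|f x| + `|g x|) \in Lfun (@leb01 R) 2%:E.
Proof.
have n2 h : h \in Lfun (@leb01 R) 2%:E ->
    (fun x => `|h x|) \in Lfun (@leb01 R) 2%:E.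
  move=> /[dup] h2 /Lfun2P[mh _].
  by apply: (Lfun2_le _ h2) => [|x]; [exact: measurableT_comp|rewrite normr_id].
move=> /n2 f2 /n2 g2.
by have [_ /(_ _ _ f2 g2)] := @Lfun_addr_closed _ _ R (@leb01 R) _ (lee1n 2).
Qed.

Lemma Ehat_Lfun2 (T0 : R -> R) rho e ehat (lam0 : R[i]) :
  measurable_fun (`[0, 1]%classic : set R) T0 ->
  (forall x, x \in `[0, 1] -> T0 x \in `[0, 1]) ->
  lipschitz_density rho -> inL2C e -> inL2C ehat ->
  Ehat T0 rho e ehat lam0 \_ `[0, 1] \in Lfun (@leb01 R) 2%:E.
Proof.
move=> mT0 T01 [[k [kreal lip]] _ _ rho0] [e1 e2] [h1 h2].
(* [lipschitz] asserts the estimate for all constants beyond a threshold [k]; this one exceeds [k]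
   whatever its sign. *)
pose M := `|k| + 1.
have lipM x y : `|rho x - rho y| <= M * `|x - y|.
  by apply: (lip M _ (x, y)); rewrite /M ?ltr_pwDr// ?ler_norm.
have crho : continuous rho by exact: lipschitz_bound_continuous lipM.
pose r := derive1 rho.
have rM z : `|r z| <= M by exact: derive1_bounded.
have r0 z : z \notin `[-1, 1] -> r z = 0 by exact: derive1_eq0_out.
have mr : measurable_fun setT r by exact: measurable_derive1.
pose I : set R := `[0, 1]%classic.
have mI : measurable I by exact: measurable_itv.
(* [T0] is measurable only on the unit interval. Extending it by zero, and inserting indicators in
   both variables of [Phi], gives a jointly measurable integrand on the whole plane that is
   unchanged on the unit square. *)
pose T0' := T0 \_ I.
have mT0' : measurable_fun setT T0' by apply/(measurable_restrictT _ mI).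
pose S (y x : R) := \sum_(i <- [:: -2; 0; 2] : seq int)
  (r (i%:~R + x - T0' y) + r (i%:~R - x - T0' y)).
pose Phi (p : R * R) :=
  \1_I p.1 * \1_I p.2 * S p.1 p.2 * Efun e ehat lam0 p.2 p.1.
rewrite (_ : _ \_ _ = (fun y => - \int[leb01]_x Phi (y, x))); last first.
  apply/funext => y; rewrite patchE; case: ifPn => yI; last first.
    under eq_Rintegral => x _ do rewrite /Phi /= indicE (negbTE yI) !mul0r.
    by rewrite Rintegral_cst// mul0r oppr0.
  rewrite /Ehat Rintegral_mkcond; congr (- _).
  apply: eq_Rintegral => x _; rewrite patchE /Phi /= !indicE yI mul1r.
  case: ifPn => xI; last by rewrite !mul0r.
  rewrite mul1r /S /tau; congr (_ * _).
  have yT : T0' y = T0 y by rewrite /T0' patchE yI.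
  have : T0 y \in `[0, 1] by apply: T01; move: yI; rewrite inE.
  rewrite in_itv/= => /andP[Ty0 Ty1].
  rewrite P_pi_unit_interval//; last by move: xI; rewrite inE.
    by rewrite yT.
  move=> z zn; apply: r0; apply: contra zn.
  by rewrite !in_itv/= => /andP[z1 z2]; apply/andP; split; lra.
suff PhiL : (fun y => \int[leb01]_x Phi (y, x)) \in Lfun (@leb01 R) 2%:E.
  apply: (Lfun2_le _ PhiL) => [|y]; last by rewrite normrN.
  by apply: measurableT_comp => //; have /Lfun2P[] := PhiL.
pose K := `|complex.Re lam0| + `|complex.Im lam0|.
(* The factor [6 * M] counts three indices with two terms each, every term being at most [M] in
   absolute value. *)
pose a x := 6 * M * K * (`|complex.Re (ehat x)| + `|complex.Im (ehat x)|).
pose b y := `|complex.Re (e y)| + `|complex.Im (e y)|.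
have m1 : measurable_fun setT (\1_I : R -> R) by exact: measurable_indic.
have mre : measurable_fun [set: R] (fun x => complex.Re (e x)).
  by have /Lfun2P[] := e1.
have mie : measurable_fun [set: R] (fun x => complex.Im (e x)).
  by have /Lfun2P[] := e2.
have mrh : measurable_fun [set: R] (fun x => complex.Re (ehat x)).
  by have /Lfun2P[] := h1.
have mih : measurable_fun [set: R] (fun x => complex.Im (ehat x)).
  by have /Lfun2P[] := h2.
have m_fst (g : R -> R) : measurable_fun setT g ->
    measurable_fun [set: R * R] (fun p => g p.1).
  by move=> mg; exact: (measurableT_comp mg measurable_fst).
have m_snd (g : R -> R) : measurable_fun setT g ->
    measurable_fun [set: R * R] (fun p => g p.2).
  by move=> mg; exact: (measurableT_comp mg measurable_snd).
have mPhi : measurable_fun [set: R * R] Phi.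
  apply: measurable_funM; [apply: measurable_funM; [apply: measurable_funM|]|].
  - exact: m_fst.
  - exact: m_snd.
  - apply: measurable_sum => i; apply: measurable_funD.
      apply: (measurableT_comp mr); apply: measurable_funB; last exact: m_fst.
      by apply: measurable_funD => //; exact: measurable_snd.
    apply: (measurableT_comp mr); apply: measurable_funB; last exact: m_fst.
    by apply: measurable_funB => //; exact: measurable_snd.
  - have := (m_fst _ mre, m_fst _ mie, m_snd _ mrh, m_snd _ mih).
    move=> [[[? ?] ?] ?]; rewrite /Efun; apply: measurable_funD;
      apply: measurable_funM; rewrite ?measurable_cst//;
      [apply: measurable_funD|apply: measurable_funB]; exact: measurable_funM.
apply: (@Lfun2_Rintegral_kernel _ _ _ leb01_finite Phi a b).
- exact: mPhi.
- apply: (@integrableZl _ _ _ leb01_finite setT measurableT (6 * M * K)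
    (EFin \o (fun x => `|complex.Re (ehat x)| + `|complex.Im (ehat x)|))).
  (* On a finite measure, square integrability of [ehat] gives the integrability needed of [a]. *)
  apply/Lfun1_integrable/Lfun_subset12; last exact: Lfun2_normD.
  exact: fin_num_measure.
- exact: Lfun2_normD.
- move=> y x; rewrite /Phi /=.
  have SM : `|S y x| <= 6 * M.
    apply: le_trans (ler_norm_sum _ _ _) _.
    apply: (@le_trans _ _ (\sum_(i <- [:: -2; 0; 2] : seq int) (2 * M))).
      apply: ler_sum => i _; apply: le_trans (ler_normD _ _) _.
      by rewrite mulr_natl mulr2n lerD.
    by rewrite !big_cons big_nil; lra.
  have EK := Efun_bound e ehat lam0 x y.
  rewrite !normrM.
  have I1 z : `|\1_I z : R| <= 1.
    by rewrite indicE; case: (_ \in _); rewrite ?normr1 ?normr0.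
  apply: (@le_trans _ _ (1 * 1 * (6 * M) * (K *
      (`|complex.Re (ehat x)| + `|complex.Im (ehat x)|) * b y))).
    by do ?[apply: ler_pM]; rewrite ?mulr_ge0.
  by rewrite /a le_eqVlt; apply/orP; left; apply/eqP; ring.
Qed.

End ResponseFunction.

Theorem proposition7p6 (R : realType) (T0 rho : R -> R)
    (T0_borel : measurable_fun (`[0, 1]%classic : set R) T0)
    (T0_range : forall x, x \in `[0, 1] -> T0 x \in `[0, 1])
    (rho_density : lipschitz_density rho)
    (A1 : mixing T0 rho)
    (lam0 : R[i]) (e ehat : R -> R[i])
    (lam0_simple : geom_simple (L0 T0 rho) lam0)
    (lam0_largest : largest_inside_disk (L0 T0 rho) lam0)
    (e_eigen : is_eigenvector (L0 T0 rho) lam0 e)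
    (ehat_eigen : is_eigenvector (L0adj T0 rho) lam0 ehat)
    (l : R) (l_ge0 : 0 <= l)
    (J_nonvanishing : ~ (forall T : L2real R, Pset T0 l T ->
       innerL2 T (Ehat T0 rho e ehat lam0) = 0)) :
  exists! T : L2real R, Pset T0 l T /\
    forall h : L2real R, Pset T0 l h ->
      innerL2 T (Ehat T0 rho e ehat lam0) <= innerL2 h (Ehat T0 rho e ehat lam0).
Proof.
(* Off the unit interval [T0], and with it [E], is arbitrary. Cutting [E] down leaves [innerL2]
   unchanged, as it integrates over that interval only. *)
pose E := Ehat T0 rho e ehat lam0; pose G := E \_ `[0, 1].
have G2 : G \in Lfun (@leb01 R) 2%:E.
  by apply: Ehat_Lfun2 => //; [case: e_eigen|case: ehat_eigen].
have JE (T : L2real R) : innerL2 T E = \int[leb01]_x (T x * G x).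
  rewrite /innerL2 Rintegral_mkcond; apply: eq_Rintegral => x _.
  by rewrite /G !patchE; case: ifPn => // _; rewrite mulr0.
(* With [Ftilde T0 l] for the set [A], the feasible set of the abstract lemma unfolds to
   [Pset T0 l]. *)
have [|M [[PM Mmin] Muniq]] :=
  @linear_form_ball_unique_minimizer _ (measurableTypeR R) R leb01 _ G
    (measurable_Ftilde l T0_borel) G2.
  by move=> J0; apply: J_nonvanishing => T PT; rewrite JE; exact: J0.
exists M; split=> [|T [PT Tmin]].
  by split=> // h Ph; rewrite !JE; exact: Mmin.
by apply: Muniq; split=> // h Ph; rewrite -!JE; exact: Tmin.
Qed.
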